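(* Let $m, n \geq 1$ be distinct integers, let $R$ be a $k$-torsion free semiprime ring, where $k=6mn(m+n)|m-n|$, and let $F: R\to R$ be a nonzero generalized $(m,n)$-Jordan derivation. Then $F$ is a derivation which maps $R$ into $Z(R)$.
   Context: $R$ is an associative ring with center $Z(R)$. For an integer $k\geq 2$, $R$ is $k$-torsion free if $kx=0$ implies $x=0$ for all $x\in R$. $R$ is semiprime if $aRa=\{0\}$ implies $a=0$. An additive map $d:R\to R$ is a derivation if $d(xy)=d(x)y+xd(y)$ for all $x,y\in R$. For fixed integers $m,n\geq 0$ with $m+n\neq 0$, an additive map $d:R\to R$ is an $(m,n)$-Jordan derivation if $(m+n)d(x^2)=2md(x)x+2nxd(x)$ for all $x\in R$; an additive map $F:R\to R$ is a generalized $(m,n)$-Jordan derivation if there exists an $(m,n)$-Jordan derivation $d:R\to R$ such that $(m+n)F(x^2)=2mF(x)x+2nxd(x)$ for all $x\in R$. *)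

(* Defs.v *)
(* Rings are NOT assumed unital: a ring is a zmodType carrier
   with an explicit associative, bi-distributive multiplication. *)
From mathcomp Require Import all_boot all_algebra.
Set Implicit Arguments. Unset Strict Implicit. Unset Printing Implicit Defensive.
Import GRing.Theory.
Local Open Scope ring_scope.

Section RingDefs.
Variables (R : zmodType) (mul : R -> R -> R).

Definition is_assoc_ring : Prop :=
  associative mul /\ left_distributive mul +%R /\ right_distributive mul +%R.

Definition in_center (z : R) : Prop := forall x, mul z x = mul x z.

Definition torsion_free (k : nat) : Prop := forall x : R, x *+ k = 0 -> x = 0.

Definition semiprime : Prop :=
  forall a : R, (forall x, mul (mul a x) a = 0) -> a = 0.

Definition additive_map (f : R -> R) : Prop := forall x y, f (x + y) = f x + f y.

Definition derivation (d : R -> R) : Prop :=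
  additive_map d /\ forall x y, d (mul x y) = mul (d x) y + mul x (d y).

Definition mn_jordan_derivation (m n : nat) (d : R -> R) : Prop :=
  additive_map d /\
  forall x, d (mul x x) *+ (m + n) = mul (d x) x *+ (2 * m) + mul x (d x) *+ (2 * n).

Definition gen_mn_jordan_derivation (m n : nat) (F : R -> R) : Prop :=
  additive_map F /\
  exists d : R -> R, mn_jordan_derivation m n d /\
    forall x, F (mul x x) *+ (m + n) = mul (F x) x *+ (2 * m) + mul x (d x) *+ (2 * n).

End RingDefs.

Definition absdiffn (m n : nat) : nat := (m - n) + (n - m).

(* Main.v *)
(* Put u = d x, D = [x, _], v = D u and e = D v.  Transporting the Jordan identity by
   an (m,n)-Jordan derivation d gives a functional identity that is linear in a
   free variable y.  Its commutators with x say that (m+n) D^2(y) v = -2m D(y) e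
   and (m+n) v D^2(y) = -2n e D(y); replacing y by products yields ezv = -vze for
   all z, and one more application of D gives eze = 0, so e = 0.  The linearization
   of e = 0 and the remaining content of the identity then force v = 0.  Once d
   commutes, it satisfies d(x^2) = 2 d(x) x, and computing d(D^2 y) from the left
   and from the right gives u D(y) + D(y) u = 0; with the functional identity this
   yields d(x) z [w, y] = 0 for all x, z, w, y, so d is central and kills
   commutators.  Finally T = F - d satisfies (m+n) T(x^2) = 2m T(x) x; the same
   transport gives T(x) x^3 = 0 and, after linearization, T(z) x^5 = 0 for all
   x and z, whence T = 0. *)
Require Import Defs.
From mathcomp Require Import all_boot all_algebra.
Import GRing.Theory.
Local Open Scope ring_scope.

(** * A decision procedure for free associative rings *)

Section RingLaws.
Variables (R : zmodType) (mul : R -> R -> R).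
Hypothesis ringR : is_assoc_ring mul.

Lemma mul_addl x y z : mul (x + y) z = mul x z + mul y z.
Proof. by case: ringR => _ [H _]; apply: H. Qed.

Lemma mul_addr x y z : mul x (y + z) = mul x y + mul x z.
Proof. by case: ringR => _ [_ H]; apply: H. Qed.

Lemma mul_assoc x y z : mul x (mul y z) = mul (mul x y) z.
Proof. by case: ringR => H _; apply: H. Qed.

Lemma mul_zerol x : mul 0 x = 0.
Proof. by apply: (addrI (mul 0 x)); rewrite -mul_addl !addr0. Qed.

Lemma mul_zeror x : mul x 0 = 0.
Proof. by apply: (addrI (mul x 0)); rewrite -mul_addr !addr0. Qed.

Lemma mul_oppl x y : mul (- x) y = - mul x y.
Proof. by apply: (addrI (mul x y)); rewrite -mul_addl !subrr mul_zerol. Qed.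

Lemma mul_oppr x y : mul x (- y) = - mul x y.
Proof. by apply: (addrI (mul x y)); rewrite -mul_addr !subrr mul_zeror. Qed.

Lemma mul_intl x y (k : int) : mul (x *~ k) y = mul x y *~ k.
Proof.
have E (c : nat) : mul (x *+ c) y = mul x y *+ c.
  by elim: c => [|c IH]; rewrite ?mulr0n ?mul_zerol // !mulrS mul_addl IH.
by case: k => c; rewrite ?NegzE ?mulrNz ?mul_oppl -!pmulrn E.
Qed.

Lemma mul_intr x y (k : int) : mul x (y *~ k) = mul x y *~ k.
Proof.
have E (c : nat) : mul x (y *+ c) = mul x y *+ c.
  by elim: c => [|c IH]; rewrite ?mulr0n ?mul_zeror // !mulrS mul_addr IH.
by case: k => c; rewrite ?NegzE ?mulrNz ?mul_oppr -!pmulrn E.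
Qed.

End RingLaws.

(** * Syntax and normal forms of noncommutative polynomials with symbolic coefficients *)

Inductive scal := SNat of nat | SVar of nat | SAdd of scal & scal
  | SOpp of scal | SMul of scal & scal.

Inductive expr := EVar of nat | EZero | EAdd of expr & expr | EOpp of expr
  | EMul of expr & expr | EScale of expr & scal.

(* [(s, c)] stands for [c] times the product of the integer atoms numbered by the
   sorted sequence [s], and [(h, w)] for the product of the ring atoms numbered
   [h :: w], a nonempty word because the ring has no unit. *)
Definition smono := (seq nat * int)%type.
Definition term := (smono * (nat * seq nat))%type.

Definition mul_smono (p q : smono) : smono :=
  (sort leq (p.1 ++ q.1), intRing.mulz p.2 q.2).
Definition opp_smono (p : smono) : smono := (p.1, intZmod.oppz p.2).

Fixpoint snorm (k : scal) : seq smono :=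
  match k with
  | SNat c => [:: ([::], Posz c)]
  | SVar i => [:: ([:: i], Posz 1)]
  | SAdd a b => snorm a ++ snorm b
  | SOpp a => map opp_smono (snorm a)
  | SMul a b => [seq mul_smono p q | p <- snorm a, q <- snorm b]
  end.

(** Cancelled terms are dropped, so that a formally zero difference normalizes to the empty list,
    which is what [norm_eq] tests. *)
Fixpoint insert (t : term) (s : seq term) : seq term :=
  if s is t' :: s' then
    if (t.1.1 == t'.1.1) && (t.2 == t'.2) then
      let c := intZmod.addz t.1.2 t'.1.2 in
      if c == Posz 0 then s' else ((t.1.1, c), t.2) :: s'
    else t' :: insert t s'
  else if t.1.2 == Posz 0 then [::] else [:: t].

Definition merge_terms (s t : seq term) := foldr insert t s.

Definition mul_term (s t : term) : term :=
  (mul_smono s.1 t.1, (s.2.1, s.2.2 ++ t.2.1 :: t.2.2)).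

Fixpoint norm (e : expr) : seq term :=
  match e with
  | EVar i => [:: (([::], Posz 1), (i, [::]))]
  | EZero => [::]
  | EAdd a b => merge_terms (norm a) (norm b)
  | EOpp a => [seq (opp_smono t.1, t.2) | t <- norm a]
  | EMul a b => merge_terms [seq mul_term s t | s <- norm a, t <- norm b] [::]
  | EScale a k =>
      merge_terms [seq (mul_smono t.1 p, t.2) | t <- norm a, p <- snorm k] [::]
  end.

Section Normalization.
Variables (R : zmodType) (mul : R -> R -> R).
Hypothesis ringR : is_assoc_ring mul.
Variables (senv : seq int) (env : seq R).

Fixpoint seval (k : scal) : int :=
  match k with
  | SNat c => Posz c
  | SVar i => nth 0 senv i
  | SAdd a b => seval a + seval b
  | SOpp a => - seval a
  | SMul a b => seval a * seval b
  end.

Fixpoint eval (e : expr) : R :=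
  match e with
  | EVar i => nth 0 env i
  | EZero => 0
  | EAdd a b => eval a + eval b
  | EOpp a => - eval a
  | EMul a b => mul (eval a) (eval b)
  | EScale a k => eval a *~ seval k
  end.

Definition smeval (p : smono) : int := (\prod_(i <- p.1) nth 0 senv i) * p.2.

Definition weval (w : nat * seq nat) : R :=
  foldl (fun x i => mul x (nth 0 env i)) (nth 0 env w.1) w.2.

Definition teval (t : term) : R := weval t.2 *~ smeval t.1.

Lemma smeval_mul p q : smeval (mul_smono p q) = smeval p * smeval q.
Proof.
rewrite /smeval.
have -> : \prod_(i <- (mul_smono p q).1) nth 0 senv i
    = \prod_(i <- p.1 ++ q.1) nth 0 senv i by apply: perm_big; rewrite perm_sort.
by rewrite big_cat -[(mul_smono p q).2]/(p.2 * q.2) mulrACA.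
Qed.

Lemma smeval_opp p : smeval (opp_smono p) = - smeval p.
Proof. by rewrite /smeval /= -[intZmod.oppz _]/(- p.2) mulrN. Qed.

Lemma snormP k : seval k = \sum_(p <- snorm k) smeval p.
Proof.
elim: k => [c|i|a IHa b IHb|a IHa|a IHa b IHb] /=.
- by rewrite big_seq1 /smeval /= big_nil mul1r.
- by rewrite big_seq1 /smeval /= big_seq1 mulr1.
- by rewrite big_cat IHa IHb.
- by rewrite big_map IHa -sumrN; apply: eq_bigr => p _; rewrite smeval_opp.
- rewrite big_allpairs_dep IHa IHb mulr_suml; apply: eq_bigr => p _.
  by rewrite mulr_sumr; apply: eq_bigr => q _; rewrite smeval_mul.
Qed.

Lemma weval_cat v w :
  weval (v.1, v.2 ++ w.1 :: w.2) = mul (weval v) (weval w).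
Proof.
rewrite /weval /= foldl_cat /=; move: (foldl _ _ v.2) (nth 0 env w.1) => x y.
elim: w.2 y => //= i s IH y.
by rewrite -(mul_assoc _ _ ringR) IH.
Qed.

Lemma sum_insert t s :
  \sum_(t' <- insert t s) teval t' = teval t + \sum_(t' <- s) teval t'.
Proof.
elim: s => [|t' s IH] /=.
  rewrite big_nil addr0; case: eqP => [E0|_]; last by rewrite big_seq1.
  by rewrite big_nil /teval /smeval E0 mulr0 mulr0z.
case: ifP => [/andP[/eqP E1 /eqP E2]|_]; last by rewrite !big_cons IH addrCA.
have E : teval t + teval t' = teval ((t.1.1, intZmod.addz t.1.2 t'.1.2), t.2).
  rewrite /teval /= -E2 -mulrzDr /smeval /= -E1 -mulrDr.
  by rewrite -[intZmod.addz _ _]/(t.1.2 + t'.1.2).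
rewrite big_cons addrA E; case: eqP => [E0|_]; last by rewrite big_cons.
by rewrite E0 /teval /smeval /= mulr0 mulr0z add0r.
Qed.

Lemma sum_merge s t :
  \sum_(p <- merge_terms s t) teval p
  = \sum_(p <- s) teval p + \sum_(p <- t) teval p.
Proof.
elim: s => [|p s IH] /=; first by rewrite big_nil add0r.
by rewrite sum_insert big_cons IH addrA.
Qed.

Lemma normP e : eval e = \sum_(t <- norm e) teval t.
Proof.
have suml (I : Type) (s : seq I) (F : I -> R) y :
    mul (\sum_(i <- s) F i) y = \sum_(i <- s) mul (F i) y.
  elim: s => [|i s IH]; rewrite ?big_nil ?(mul_zerol _ _ ringR) //.
  by rewrite !big_cons (mul_addl _ _ ringR) IH.
have sumr (I : Type) (s : seq I) (F : I -> R) y :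
    mul y (\sum_(i <- s) F i) = \sum_(i <- s) mul y (F i).
  elim: s => [|i s IH]; rewrite ?big_nil ?(mul_zeror _ _ ringR) //.
  by rewrite !big_cons (mul_addr _ _ ringR) IH.
elim: e => [i||a IHa b IHb|a IHa|a IHa b IHb|a IHa k] /=.
- by rewrite big_seq1 /teval /smeval /= big_nil mulr1 mulr1z.
- by rewrite big_nil.
- by rewrite sum_merge IHa IHb.
- rewrite big_map IHa -sumrN; apply: eq_bigr => t _.
  by rewrite /teval smeval_opp mulrNz.
- rewrite sum_merge big_nil addr0 big_allpairs_dep IHa IHb suml.
  apply: eq_bigr => s _; rewrite sumr; apply: eq_bigr => t _.
  rewrite /teval /= smeval_mul weval_cat (mul_intl _ _ ringR).
  by rewrite (mul_intr _ _ ringR) -mulrzA [X in _ *~ X]mulrC.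
- rewrite sum_merge big_nil addr0 big_allpairs_dep IHa snormP.
  rewrite mulrz_suml; apply: eq_bigr => t _.
  rewrite mulrz_sumr; apply: eq_bigr => p _.
  by rewrite /teval /= smeval_mul mulrzA.
Qed.

Lemma norm_eq a b : norm (EAdd a (EOpp b)) = [::] -> eval a = eval b.
Proof.
by move=> E; apply/eqP; rewrite -subr_eq0; apply/eqP;
  rewrite -[LHS]/(eval (EAdd a (EOpp b))) normP E big_nil.
Qed.

End Normalization.

(** * Reification of ring equalities *)

Ltac nc_mem x l :=
  lazymatch l with
  | [::] => constr:(false)
  | x :: _ => constr:(true)
  | _ :: ?l' => nc_mem x l'
  end.

Ltac nc_insert x l :=
  let b := nc_mem x l in
  lazymatch b with true => l | false => constr:(x :: l) end.

Ltac nc_index x l :=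
  lazymatch l with
  | x :: _ => constr:(0%N)
  | _ :: ?l' => let i := nc_index x l' in constr:(S i)
  end.

Ltac nc_satoms k l :=
  lazymatch k with
  | ?a + ?b => let l := nc_satoms a l in nc_satoms b l
  | - ?a => nc_satoms a l
  | ?a * ?b => let l := nc_satoms a l in nc_satoms b l
  | 0 => l
  | 1 => l
  | 1 *+ _ => l
  | _ => nc_insert k l
  end.

Ltac nc_atoms mul t ls :=
  lazymatch t with
  | 0 => ls
  | ?a + ?b => let ls := nc_atoms mul a ls in nc_atoms mul b ls
  | - ?a => nc_atoms mul a ls
  | mul ?a ?b => let ls := nc_atoms mul a ls in nc_atoms mul b ls
  | ?a *~ ?k =>
      lazymatch nc_atoms mul a ls with
      | (?l, ?s) => let s := nc_satoms k s in constr:((l, s))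
      end
  | _ =>
      lazymatch ls with
      | (?l, ?s) => let l := nc_insert t l in constr:((l, s))
      end
  end.

Ltac nc_scal s k :=
  lazymatch k with
  | ?a + ?b => let a := nc_scal s a in let b := nc_scal s b in constr:(SAdd a b)
  | - ?a => let a := nc_scal s a in constr:(SOpp a)
  | ?a * ?b => let a := nc_scal s a in let b := nc_scal s b in constr:(SMul a b)
  | 0 => constr:(SNat 0)
  | 1 => constr:(SNat 1)
  | 1 *+ ?c => constr:(SNat c)
  | _ => let i := nc_index k s in constr:(SVar i)
  end.

Ltac nc_expr mul l s t :=
  lazymatch t with
  | 0 => constr:(EZero)
  | ?a + ?b =>
      let a := nc_expr mul l s a in let b := nc_expr mul l s b in
      constr:(EAdd a b)
  | - ?a => let a := nc_expr mul l s a in constr:(EOpp a)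
  | mul ?a ?b =>
      let a := nc_expr mul l s a in let b := nc_expr mul l s b in
      constr:(EMul a b)
  | ?a *~ ?k =>
      let a := nc_expr mul l s a in let k := nc_scal s k in
      constr:(EScale a k)
  | _ => let i := nc_index t l in constr:(EVar i)
  end.

(* Decides equalities in the free associative ring without unit over a
   polynomial ring with integer coefficients. *)
Ltac nc :=
  lazymatch goal with
  | ringR : @is_assoc_ring ?R ?mul |- ?a = ?b =>
    let ls := nc_atoms mul a ((@nil R), (@nil int)) in
    lazymatch nc_atoms mul b ls with
    | (?l, ?s) =>
      let ea := nc_expr mul l s a in
      let eb := nc_expr mul l s b in
      apply: (norm_eq R mul ringR s l ea eb); vm_compute; reflexivity
    end
  end.

(** * Linear combinations of equations with right-hand side 0 *)

Section Combinations.
Variables (R : zmodType) (mul : R -> R -> R).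
Hypothesis ringR : is_assoc_ring mul.

Lemma mul_eq0l z (x : R) : x = 0 -> mul z x = 0.
Proof. by move=> ->; rewrite (mul_zeror _ _ ringR). Qed.

Lemma mul_eq0r (x : R) z : x = 0 -> mul x z = 0.
Proof. by move=> ->; rewrite (mul_zerol _ _ ringR). Qed.

Lemma mulrz_eq0l (x : R) k : x = 0 -> x *~ k = 0.
Proof. by move=> ->; rewrite mul0rz. Qed.

Lemma add_eq0 (x y : R) : x = 0 -> y = 0 -> x + y = 0.
Proof. by move=> -> ->; rewrite addr0. Qed.

Lemma sub_eq0 (x y : R) : x = 0 -> y = 0 -> x - y = 0.
Proof. by move=> -> ->; rewrite subr0. Qed.

End Combinations.

(* Closes the goal [a = 0] when [a] equals, in the free ring, the left-hand side
   of the equation [H : b = 0]. *)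
Ltac combine H := refine (eq_trans _ H); nc.

(** * The functional identity at a fixed element *)

(** The scalar is an integer so that [m - n] may have either sign. *)
Definition regular (R : zmodType) (k : int) := forall x : R, x *~ k = 0 -> x = 0.

Section Pointwise.
Variables (R : zmodType) (mul : R -> R -> R) (m n : int).
Hypothesis ringR : is_assoc_ring mul.
Hypothesis semiR : semiprime mul.
Hypotheses (reg2 : regular R 2) (reg3 : regular R 3).
Hypotheses (regm : regular R m) (regn : regular R n).
Hypotheses (regS : regular R (m + n)) (regG : regular R (m - n)).

Local Notation "x ** y" := (mul x y) (at level 40, left associativity).
Local Notation "[< x , y >]" := (x ** y - y ** x).
Local Notation "z *l H" := (mul_eq0l _ _ ringR z _ H) (at level 40).
Local Notation "H *r z" := (mul_eq0r _ _ ringR _ z H) (at level 40).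
Local Notation "H *s k" := (mulrz_eq0l _ _ k H) (at level 40).
Local Notation "H +h K" := (add_eq0 _ _ _ H K) (at level 50, left associativity).
Local Notation "H -h K" := (sub_eq0 _ _ _ H K) (at level 50, left associativity).

(** Moving [a] across [b] in two ways gives [p - q] times [b y a z b], and [b r a z b = 0] makes
    [a z b r a z b] vanish. *)
Lemma mul_eq0_of_swap p q a b : regular R (p - q) ->
  (forall z, a ** z ** b *~ p - b ** z ** a *~ q = 0) ->
  forall z, a ** z ** b = 0.
Proof.
move=> reg H.
have X y z : b ** y ** a ** z ** b = 0.
  apply: reg.
  combine (b ** y *l H z -h H (y ** b ** z) +h H y *r (z ** b)).
move=> z; apply: semiR => r.
combine (a ** z *l X r z).
Qed.

Section FixedElement.
Variables x u : R.
Local Notation D y := [< x, y >].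
Local Notation v := [< x, u >].
Local Notation e := [< x, [< x, u >] >].

(** This will be [mn_functional_identity] with [u = d x]; only [y] varies. *)
Hypothesis E0 : forall y,
  u ** x ** y ** x *~ (2 * m * m)
  - (u ** x ** x ** y + u ** y ** x ** x) *~ (m * (m + n))
  + (x ** u ** y ** x + x ** u ** x ** y + y ** u ** x ** x
     - y ** x ** u ** x - x ** y ** u ** x - x ** x ** u ** y) *~ (2 * m * n)
  - x ** y ** x ** u *~ (2 * n * n)
  + (y ** x ** x ** u + x ** x ** y ** u) *~ (n * (m + n)) = 0.

Lemma comm3_eq0 : [< x, e >] = 0.
Proof. by apply/reg2/regm/regn; combine (E0 x). Qed.

(** Passing from [y] to [y x] only affects terms with [u] to the right of [y]; the others cancel
    against the identity multiplied by [x]. *)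
Lemma commr_e y : D (D y) ** v *~ (m + n) + D y ** e *~ (2 * m) = 0.
Proof.
apply: regn.
combine (E0 (y ** x) -h E0 y *r x -h (y *l comm3_eq0) *s (2 * m * n)).
Qed.

Lemma comml_e y : v ** D (D y) *~ (m + n) + e ** D y *~ (2 * n) = 0.
Proof.
apply: regm.
combine (E0 (x ** y) -h x *l E0 y -h (comm3_eq0 *r y) *s (2 * m * n)).
Qed.

Lemma comm2_eq0 : e = 0.
Proof.
have Ar y z : (D (D y) ** z ** v + D y ** D z ** v *~ 2) *~ (m + n)
    + D y ** z ** e *~ (2 * m) = 0.
  combine (commr_e (y ** z) -h y *l commr_e z).
have Al y z : (v ** z ** D (D y) + v ** D z ** D y *~ 2) *~ (m + n)
    + e ** z ** D y *~ (2 * n) = 0.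
  combine (comml_e (z ** y) -h comml_e z *r y).
(* At [y = u] both identities contain the same multiple of [v (D z) v]; their difference is [m - n]
   times the claim. *)
have Q z : e ** z ** v + v ** z ** e = 0.
  by apply: regG; combine (Ar u z -h Al u z).
apply: semiR => z; apply: reg2.
combine (x *l Q z -h Q z *r x -h Q (D z)
  -h comm3_eq0 *r (z ** v) -h (v ** z) *l comm3_eq0).
Qed.

(** Linearization of [[x, [x, d x]] = 0], with [w = d z]. The witness only enters through [D (D w)],
    which [v] annihilates on both sides. *)
Hypothesis E1 : forall z, exists w,
  D (D w) + [< D z, u >] + [< z, v >] *~ 2 = 0.

Lemma comm_eq0 : v = 0.
Proof.
have e0 := comm2_eq0.
have DDv y : D (D y) ** v = 0.
  by apply: regS; combine (commr_e y -h (D y *l e0) *s (2 * m)).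
have vDD y : v ** D (D y) = 0.
  by apply: regS; combine (comml_e y -h (e0 *r D y) *s (2 * n)).
have DDzv y z : D (D y) ** z ** v + D y ** D z ** v *~ 2 = 0.
  combine (DDv (y ** z) -h y *l DDv z).
have vDv z : v ** D z ** v = 0.
  by apply: reg2; combine (DDzv u z -h e0 *r (z ** v)).
have E' y : D (D y) ** u *~ (n * (m + n)) - u ** D (D y) *~ (m * (m + n))
    + (D y ** v - v ** D y) *~ (2 * m * n) = 0.
  combine (E0 y -h (y *l e0) *s (2 * m * n) +h (e0 *r y) *s (2 * m * n)).
have Dvv y : D y ** v ** v = 0.
  apply/reg2/regn/regn.
  combine (DDzv y u *s (n * (m + n)) -h E' y *r v -h (u *l DDv y) *s (m * (m + n))
    -h vDv y *s (2 * m * n)).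
have v2 : v ** v = 0.
  apply: semiR => z.
  combine (v *l Dvv (u ** z) -h (v ** u) *l Dvv z).
have E2 y : D y ** v ** u *~ (n * n) + D y ** u ** v *~ (m * n)
    - u ** D y ** v *~ (m * (m + n)) - v ** y ** v *~ (m * n) = 0.
  apply: reg2.
  combine (E' (y ** u) -h E' y *r u -h (y *l e0 *r u) *s (n * (m + n))
    +h ((u ** y) *l e0) *s (m * (m + n)) -h (y *l v2) *s (2 * m * n)).
have E3 y : u ** v ** D y *~ (m * m) + v ** u ** D y *~ (m * n)
    - v ** D y ** u *~ (n * (m + n)) - v ** y ** v *~ (m * n) = 0.
  apply: reg2.
  combine (u *l E' y -h E' (u ** y) +h (e0 *r (y ** u)) *s (n * (m + n))
    -h (u *l e0 *r y) *s (m * (m + n)) -h (v2 *r y) *s (2 * m * n)).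
(* For [s = n v u + m u v], comparing [E2] at [u z] with [u] times [E2] at [z] gives
   [m s z v = n v z s]. *)
have s0 : v ** u *~ n + u ** v *~ m = 0.
  have sv := mul_eq0_of_swap m n (v ** u *~ n + u ** v *~ m) v regG.
  have svz z : (v ** u *~ n + u ** v *~ m) ** z ** v = 0.
    by apply: sv => {}z; combine (u *l E2 z -h E2 (u ** z)).
  by apply: semiR => z; combine (svz z *r u *s n +h svz (z ** u) *s m).
have H1 y : u ** D y ** v *~ (m + n) + v ** y ** v *~ n = 0.
  by apply: regm; combine ((D y *l s0) *s n -h E2 y).
have H2 y : v ** D y ** u *~ (m + n) + v ** y ** v *~ m = 0.
  by apply: regn; combine ((s0 *r D y) *s m -h E3 y).
have H3 z : v ** u ** D z *~ (m + n)
    - v ** z ** v *~ (2 * (m + n) - m) = 0.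
  have [w L] := E1 z.
  combine (vDD w *s (m + n) +h H2 z -h (v2 *r z) *s (2 * (m + n))
    -h (v *l L) *s (m + n)).
have vu0 : v ** u = 0.
  (* The swap below is between [v u] and [v], with coefficients [m] and [m - 2 (m + n)], whose
     difference is [2 (m + n)]. *)
  have reg2S : regular R (m - (m - 2 * (m + n))).
    move=> y Hy; apply/reg2/regS.
    combine Hy.
  have vuv := mul_eq0_of_swap _ _ (v ** u) v reg2S.
  have {}vuv z : v ** u ** z ** v = 0.
    apply: vuv => {}z; apply: regS.
    combine ((H3 (z ** u) -h H3 z *r u) *s m
      +h ((v ** z) *l s0) *s (2 * (m + n) - m)).
  by apply: semiR => z; combine (vuv z *r u).
have uv0 : u ** v = 0 by apply: regm; combine (s0 -h vu0 *s n).
(* Multiplying [L] by [v] on the left gives [2 (m + n) - m] times [v z v], and on the right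
   [2 (m + n) - n] times it; the sum is [3 (m + n) v z v]. *)
apply: semiR => z; have [w L] := E1 z; apply/reg3/regS.
combine ((v *l L) *s (m + n) -h vDD w *s (m + n) -h H2 z +h (vu0 *r D z) *s (m + n)
  +h (v2 *r z) *s (2 * (m + n))
  +h (DDv w *s (m + n) +h (D z *l uv0) *s (m + n) -h H1 z
  +h (z *l v2) *s (2 * (m + n)) -h (L *r v) *s (m + n))).
Qed.
End FixedElement.
End Pointwise.

(** * Jordan maps *)

Section JordanMaps.
Variables (R : zmodType) (mul : R -> R -> R).
Hypothesis ringR : is_assoc_ring mul.
Hypothesis semiR : semiprime mul.

Local Notation "x ** y" := (mul x y) (at level 40, left associativity).
Local Notation "[< x , y >]" := (x ** y - y ** x).
Local Notation "z *l H" := (mul_eq0l _ _ ringR z _ H) (at level 40).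
Local Notation "H *r z" := (mul_eq0r _ _ ringR _ z H) (at level 40).
Local Notation "H *s k" := (mulrz_eq0l _ _ k H) (at level 40).
Local Notation "H +h K" := (add_eq0 _ _ _ H K) (at level 50, left associativity).
Local Notation "H -h K" := (sub_eq0 _ _ _ H K) (at level 50, left associativity).

Section Additive.
Variable d : R -> R.
Hypothesis dD : additive_map d.

Lemma additive0 : d 0 = 0.
Proof. by apply: (addrI (d 0)); rewrite -dD !addr0. Qed.

Lemma additiveN x : d (- x) = - d x.
Proof. by apply: (addrI (d x)); rewrite -dD !subrr additive0. Qed.

Lemma additiveB x y : d (x - y) = d x - d y.
Proof. by rewrite dD additiveN. Qed.

Section JordanIdentity.
Variables p q s : int.
Hypothesis d_sqr : forall x,
  d (x ** x) *~ s - d x ** x *~ (2 * p) - x ** d x *~ (2 * q) = 0.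

Lemma jordan_lin x y : d (x ** y + y ** x) *~ s
  - (d x ** y + d y ** x) *~ (2 * p) - (x ** d y + y ** d x) *~ (2 * q) = 0.
Proof.
have := d_sqr (x + y).
have -> : (x + y) ** (x + y) = x ** x + (x ** y + y ** x) + y ** y by nc.
by rewrite !dD => H; combine (H -h d_sqr x -h d_sqr y).
Qed.

(** With this notation [jordan_lin] reads [s d(z y + y z) = M z (d y) + M y (d z)]. *)
Local Notation M z w := (w ** z *~ (2 * p) + z ** w *~ (2 * q)).
Local Notation "z *o H" := ((H *r z) *s (2 * p) +h (z *l H) *s (2 * q)) (at level 40).

(* This is [d] applied to [(x^2 o y) o x = x^2 o (y o x)]: all the terms in
   [d y] cancel because left and right multiplications by [x] and
   [x^2] commute. *)
Lemma jordan_transport x y :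
  M x (M y (M x (d x))) + M (x ** x ** y + y ** (x ** x)) (d x) *~ (s * s)
  - M (x ** y + y ** x) (M x (d x)) *~ s - M (x ** x) (M y (d x)) *~ s = 0.
Proof.
have Hl := jordan_lin (x ** x ** y + y ** (x ** x)) x.
have := jordan_lin (x ** x) (x ** y + y ** x).
have -> : x ** x ** (x ** y + y ** x) + (x ** y + y ** x) ** (x ** x)
  = (x ** x ** y + y ** (x ** x)) ** x + x ** (x ** x ** y + y ** (x ** x)) by nc.
move=> Hr.
combine (Hr *s (s * s) +h (x ** x) *o (jordan_lin x y) *s s
  +h (x ** y + y ** x) *o (d_sqr x) *s s
  -h Hl *s (s * s) -h x *o (jordan_lin (x ** x) y) *s s -h x *o (y *o (d_sqr x))).
Qed.
End JordanIdentity.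
End Additive.

Hypotheses (reg2 : regular R 2) (reg3 : regular R 3).
Variables m n : int.
Hypotheses (regm : regular R m) (regn : regular R n).
Hypotheses (regS : regular R (m + n)) (regG : regular R (m - n)).

Section Derivation.
Variable d : R -> R.
Hypothesis dD : additive_map d.
Hypothesis d_sqr : forall x,
  d (x ** x) *~ (m + n) - d x ** x *~ (2 * m) - x ** d x *~ (2 * n) = 0.

Lemma mn_functional_identity x y :
  d x ** x ** y ** x *~ (2 * m * m)
  - (d x ** x ** x ** y + d x ** y ** x ** x) *~ (m * (m + n))
  + (x ** d x ** y ** x + x ** d x ** x ** y + y ** d x ** x ** x
     - y ** x ** d x ** x - x ** y ** d x ** x - x ** x ** d x ** y) *~ (2 * m * n)
  - x ** y ** x ** d x *~ (2 * n * n)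
  + (y ** x ** x ** d x + x ** x ** y ** d x) *~ (n * (m + n)) = 0.
Proof.
apply/reg2/regG.
combine (jordan_transport d dD m n (m + n) d_sqr x y).
Qed.

Lemma mn_commuting x : [< x, d x >] = 0.
Proof.
have e0 z : [< z, [< z, d z >] >] = 0.
  exact: comm2_eq0 ringR semiR reg2 regm regn regG _ _ (mn_functional_identity z).
apply: (comm_eq0 R mul m n) => // [y|z]; first exact: mn_functional_identity.
exists (d z); apply: reg2.
have := e0 (x + z); have := e0 (x - z); rewrite !dD (additiveN _ dD) => Hm Hp.
combine (Hp -h Hm -h e0 z *s 2).
Qed.

Lemma mn_lin x y : d (x ** y + y ** x) - (d x ** y + d y ** x) *~ 2 = 0.
Proof.
(* Since [d z] commutes with [z], the map [d] is a Jordan map with parameters [p = 1], [q = 0],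
   [s = 1]. *)
have sq z : d (z ** z) *~ 1 - d z ** z *~ (2 * 1) - z ** d z *~ (2 * 0) = 0.
  by apply: regS; combine (d_sqr z +h mn_commuting z *s (2 * n)).
combine (jordan_lin d dD 1 0 1 sq x y).
Qed.

Lemma mn_comm_sym x y : [< x, d y >] + [< y, d x >] = 0.
Proof.
have := mn_commuting (x + y); rewrite dD => H.
combine (H -h mn_commuting x -h mn_commuting y).
Qed.

(** Writing [a o b = a b + b a], one has [[x, [x, y]] = 2 (x^2 o y) - x o (x o y)]. Applying [d]
    gives [6 (d x) [x, y]] by the left form of the linearization and [-6 [x, y] (d x)] by the right
    form [lin']. *)
Lemma mn_comm_anti x y : d x ** [< x, y >] + [< x, y >] ** d x = 0.
Proof.
have lin' a b : d (a ** b + b ** a) - (b ** d a + a ** d b) *~ 2 = 0.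
  combine (mn_lin a b -h mn_comm_sym a b *s 2).
have sq : d (x ** x) - d x ** x *~ 2 = 0.
  have := mn_lin x x; rewrite dD => H; apply: reg2; combine H.
apply/reg2/reg3.
combine ((lin' (x ** x) y +h (y *l sq) *s 2 -h (y *l mn_commuting x) *s 4) *s 2
  -h lin' x (x ** y + y ** x) -h (x *l lin' x y) *s 2
  -h ((mn_lin (x ** x) y +h (sq *r y) *s 2) *s 2
  -h mn_lin x (x ** y + y ** x) -h (mn_lin x y *r x) *s 2)).
Qed.

(** Once [d x] commutes with [x], the functional identity compares [d x] times the double commutator
    with its reverse product; anticommutation turns this into a factor [(m + n)^2]. *)
Lemma mn_mul_comm2 x y : d x ** [< x, [< x, y >] >] = 0.
Proof.
have c := mn_commuting x; apply/regS/regS.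
combine (mn_comm_anti x [< x, y >] *s (n * (m + n)) -h mn_functional_identity x y
  +h (c *r (y ** x) -h x *l c *r y -h y *l c *r x +h (x ** y) *l c) *s (2 * m * n)).
Qed.

Lemma mn_sqr_mul_comm x y : d x ** d x ** [< x, y >] = 0.
Proof.
have c := mn_commuting x; have DD0 := mn_mul_comm2 x; have A := mn_comm_anti x.
(* [mn_mul_comm2] at [a (d x) b] leaves only the cross term of the Leibniz rule, in which the inner
   [d x] anticommutes with [[x, a]]. *)
have Q a b : d x ** d x ** [< x, a >] ** [< x, b >] = 0.
  apply: reg2.
  combine ((d x *l A a *r [< x, b >]) *s 2
    -h (DD0 (a ** (d x ** b)) -h DD0 a *r (d x ** b) -h (d x ** a) *l DD0 b
      -h ((d x ** [< x, a >]) *l c *r b) *s 2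
      -h (d x ** a) *l ((c *r [< x, b >]) *s 2 +h x *l c *r b -h c *r (x ** b)))).
apply: semiR => z.
combine (Q y (z ** d x ** d x ** y) -h Q y z *r (d x ** d x ** y)
  -h (d x ** d x ** [< x, y >] ** z) *l (c *r (d x ** y) +h d x *l c *r y)).
Qed.

Lemma mn_mul_comm_eq0 x y : d x ** [< x, y >] = 0.
Proof.
have A := mn_comm_anti x; have DD0 := mn_mul_comm2.
have L z : d z ** [< x, [< x, y >] >]
    + d x ** ([< z, [< x, y >] >] + [< x, [< z, y >] >]) = 0.
  apply: reg2; have := DD0 (x + z) y; have := DD0 (x - z) y.
  rewrite !dD (additiveN _ dD) => Hm Hp.
  combine (Hp -h Hm -h DD0 z y *s 2).
(* Multiplying [L z] on the right by [d x] leaves [(d x) [z, [x, y]] (d x) = 0]; anticommutation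
   gives the stated form. *)
have G z : d x ** z ** d x ** [< x, y >] - [< x, y >] ** d x ** z ** d x = 0.
  combine (d z *l (A [< x, y >] -h DD0 x y) +h (d x ** z) *l A y -h A y *r (z ** d x)
    +h d x *l A [< z, y >] -h mn_sqr_mul_comm x [< z, y >] -h L z *r d x).
have H z t : d x ** z ** d x ** [< x, y >] ** t ** d x = 0.
  apply: reg2.
  combine (G z *r (t ** d x) -h G (z ** d x ** t) +h (d x ** z) *l G t
    +h (d x ** z) *l A y *r (t ** d x)).
have K z : d x ** z ** d x ** [< x, y >] = 0.
  by apply: semiR => t; combine (H z t *r (z ** d x ** [< x, y >])).
apply: semiR => z.
combine (A y *r (z ** d x ** [< x, y >]) -h [< x, y >] *l K z).
Qed.

Lemma mn_mul_comm x z w y : d x ** z ** [< w, y >] = 0.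
Proof.
have D0 := mn_mul_comm_eq0.
have U a b c : d a ** b ** [< a, c >] = 0.
  combine (D0 a (b ** c) -h D0 a b *r c).
have := U (x + w) z y; rewrite dD => H.
apply: semiR => r.
combine ((d x ** z ** [< w, y >] ** r) *l (H -h U x z y -h U w z y)
  -h U x (z ** [< w, y >] ** r ** d w ** z) y).
Qed.

Lemma mn_central x y : [< d x, y >] = 0.
Proof.
apply: semiR => z.
combine (mn_mul_comm x (y ** z) (d x) y -h y *l mn_mul_comm x z (d x) y).
Qed.

(** For a commutator [q], linearizing at [d q] and [q] shows that [d q] squares to zero; being
    central, it vanishes by semiprimeness. *)
Lemma mn_comm_eq0 x y : d [< x, y >] = 0.
Proof.
have C a b c : d a ** [< b, c >] = 0.
  by apply: semiR => r; combine (mn_mul_comm a ([< b, c >] ** r ** d a) b c).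
set q := [< x, y >].
have fq : d q ** q = 0 by exact: C.
have qf : q ** d q = 0 by combine (fq -h mn_central q q).
have ddq : d (d q) ** q = 0 by exact: C.
have ff : d q ** d q = 0.
  apply: reg2; have := mn_lin (d q) q; rewrite fq qf addr0 (additive0 _ dD) => H.
  combine (H *s (-1) -h ddq *s 2).
apply: semiR => z.
combine (ff *r z -h d q *l mn_central q z).
Qed.

Lemma mn_derivation : derivation mul d.
Proof.
split=> // x y; apply/eqP; rewrite -subr_eq0; apply/eqP; apply: reg2.
have := mn_lin x y; have := mn_comm_eq0 x y; rewrite (additiveB _ dD) dD => H K.
combine (K +h H +h mn_central y x *s 2).
Qed.

End Derivation.

(** * Vanishing of one-sided Jordan maps *)

Lemma power5_annihilator t : (forall x, t ** x ** x ** x ** x ** x = 0) -> t = 0.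
Proof.
move=> H5.
have H4 x : t ** x ** x ** x ** x = 0.
  have P y : t ** (x ** x ** x ** x ** y + x ** x ** x ** y ** x
      + x ** x ** y ** x ** x + x ** y ** x ** x ** x + y ** x ** x ** x ** x) = 0.
    (* The values at [x + y], [x - y], [x + 2y], [x - 2y] are weighted to kill the even and cubic
       parts in [y]: 12 times the linear part remains, after the quintic part is restored by 48. *)
    apply/reg2/reg2/reg3.
    combine ((H5 (x + y) -h H5 (x - y)) *s 8 -h H5 (x + y *~ 2) +h H5 (x - y *~ 2)
      +h H5 y *s 48).
  apply: semiR => r.
  (* Every term of [P] but the first vanishes at [y = r t x^4], as [y x = 0]. *)
  combine (P (r ** (t ** x ** x ** x ** x))
    -h (t ** x ** x ** x ** r) *l H5 x -h (t ** x ** x ** r) *l H5 x *r x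
    -h (t ** x ** r) *l H5 x *r (x ** x) -h (t ** r) *l H5 x *r (x ** x ** x)).
have H3 x : t ** x ** x ** x = 0.
  have P y : t ** (x ** x ** x ** y + x ** x ** y ** x
      + x ** y ** x ** x + y ** x ** x ** x) = 0.
    apply/reg2/reg2/reg3.
    combine ((H4 (x + y) -h H4 (x - y)) *s 8 -h H4 (x + y *~ 2) +h H4 (x - y *~ 2)).
  apply: semiR => r.
  combine (P (r ** (t ** x ** x ** x))
    -h (t ** x ** x ** r) *l H4 x -h (t ** x ** r) *l H4 x *r x
    -h (t ** r) *l H4 x *r (x ** x)).
have H2 x : t ** x ** x = 0.
  have P y : t ** (x ** x ** y + x ** y ** x + y ** x ** x) = 0.
    apply: reg2.
    combine (H3 (x + y) -h H3 (x - y) -h H3 y *s 2).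
  apply: semiR => r.
  combine (P (r ** (t ** x ** x)) -h (t ** x ** r) *l H3 x -h (t ** r) *l H3 x *r x).
have H1 x : t ** x = 0.
  apply: semiR => r.
  combine (H2 (x + r ** t ** x) -h H2 x -h H2 (r ** t ** x) -h (t ** r) *l H2 x).
by apply: semiR => r; exact: (H1 r *r t).
Qed.

Section Centralizer.
Variable T : R -> R.
Hypothesis TD : additive_map T.
Hypothesis T_sqr : forall x, T (x ** x) *~ (m + n) - T x ** x *~ (2 * m) = 0.

Lemma mn_centralizer_eq0 z : T z = 0.
Proof.
(* The transported identity with [q = 0] is [2 m (m - n)] times this one. *)
have J x y : T x ** x ** y ** x *~ (2 * m)
    - T x ** (x ** x ** y + y ** x ** x) *~ (m + n) = 0.
  have sq a : T (a ** a) *~ (m + n) - T a ** a *~ (2 * m) - a ** T a *~ (2 * 0) = 0.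
    combine (T_sqr a).
  apply/reg2/regm/regG.
  combine (jordan_transport T TD m 0 (m + n) sq x y).
have C x : T x ** x ** x ** x = 0.
  by apply/reg2/regn; combine (J x x *s (-1)).
apply: power5_annihilator => x.
have L : T z ** x ** x ** x + T x ** (z ** x ** x + x ** z ** x + x ** x ** z) = 0.
  (* The weights 6, -1, -2 for the values at [x + z], [x + 2z], [x - z] remove the parts of degree 2
     and 3 in [z] and leave 6 times the linear part. *)
  apply/reg2/reg3.
  have := C (x + z); have := C (x - z); have := C (x + z + z).
  rewrite !TD (additiveN _ TD) => F2 Fm Fp.
  combine (Fp *s 6 -h F2 -h Fm *s 2 -h C x *s 3 +h C z *s 12).
(* By [C], the identity [J] at [x x z] gives [(T x) x z' x^2 = 0] with [z' = x z]; substituting this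
   in [J] at [x z], multiplied by [x], isolates the claim. *)
have B : T x ** x ** z ** x ** x ** x = 0.
  apply/regS/regS.
  combine (((C x *r (z ** x)) *s (2 * m) -h (C x *r (x ** z)) *s (m + n)
      -h J x (x ** x ** z)) *s (2 * m)
    -h (C x *r (z ** x)) *s ((m + n) * (m + n)) -h (J x (x ** z) *r x) *s (m + n)).
apply: regS.
combine ((L *r (x ** x)) *s (m + n) +h J x z *r (x ** x) -h B *s (m + n + 2 * m)).
Qed.
End Centralizer.

End JordanMaps.

(** * Torsion hypotheses and the conclusion *)

Lemma regular_dvdn (R : zmodType) (j k : nat) :
  torsion_free R k -> (j %| k)%N -> regular R j.
Proof.
move=> tf /dvdnP[c Ek] x; rewrite -pmulrn => xj0; apply: tf.
by rewrite Ek mulnC mulrnA xj0 mul0rn.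
Qed.

Lemma regular_absdiffn (R : zmodType) (m n : nat) :
  regular R (absdiffn m n) -> regular R (Posz m - Posz n).
Proof.
rewrite /absdiffn => reg x; have [nm | /ltnW mn] := leqP n m.
  by move: reg; rewrite (eqP nm) addn0 subzn // => reg /reg.
move: reg; rewrite (eqP mn) add0n -opprB subzn // mulrNz => reg.
by move=> /eqP; rewrite oppr_eq0 => /eqP/reg.
Qed.

Theorem theorem1p3 (R : zmodType) (mul : R -> R -> R) (m n : nat) (F : R -> R) :
  is_assoc_ring mul ->
  (1 <= m)%N -> (1 <= n)%N -> m <> n ->
  semiprime mul ->
  torsion_free R (6 * m * n * (m + n) * absdiffn m n)%N ->
  gen_mn_jordan_derivation mul m n F ->
  (exists x, F x <> 0) ->
  derivation mul F /\ (forall x, in_center mul (F x)).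
Proof.
move=> ringR _ _ _ semiR tf [FD [d [[dD dJ] FJ]]] _.
have reg j : (j %| 6 * m * n * (m + n) * absdiffn m n)%N -> regular R j.
  exact: regular_dvdn tf.
have reg2 : regular R 2 by apply: (reg 2%N); rewrite -!mulnA dvdn_mulr.
have reg3 : regular R 3 by apply: (reg 3%N); rewrite -!mulnA dvdn_mulr.
have regm : regular R m by apply: reg; rewrite -!mulnA mulnCA dvdn_mulr.
have regn : regular R n by apply: reg; rewrite -!mulnA 2!(mulnCA _ n) dvdn_mulr.
have regS : regular R (Posz m + Posz n).
  by apply: (reg (m + n)%N); rewrite dvdn_mulr // dvdn_mull.
have regG : regular R (Posz m - Posz n).
  by apply/regular_absdiffn/reg; rewrite dvdn_mull.
have sqr f g : (forall x, f (mul x x) *+ (m + n)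
      = mul (f x) x *+ (2 * m) + mul x (g x) *+ (2 * n)) ->
    forall x, f (mul x x) *~ (Posz m + Posz n) - mul (f x) x *~ (2 * Posz m)
      - mul x (g x) *~ (2 * Posz n) = 0.
  move=> fJ x; apply/eqP; rewrite -addrA -opprD subr_eq0; apply/eqP.
  by have := fJ x; rewrite !pmulrn PoszD !PoszM.
have {}dJ := sqr _ _ dJ; have {}FJ := sqr _ _ FJ.
(* Both identities carry the same term in [x (d x)], so it cancels in the one for [F - d]. *)
have Fd x : F x = d x.
  apply/eqP; rewrite -subr_eq0; apply/eqP.
  apply: (mn_centralizer_eq0 _ _ ringR semiR reg2 reg3 m n regm regn regS regG
    (fun x => F x - d x)) => [a b | a].
    by rewrite /= FD dD; nc.
  by combine (sub_eq0 _ _ _ (FJ a) (dJ a)).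
have [_ dM] : derivation mul d.
  exact: mn_derivation ringR semiR reg2 reg3 m n regm regn regS regG d dD dJ.
split=> [|x y]; first by split=> // x y; rewrite !Fd dM.
rewrite Fd; apply/eqP; rewrite -subr_eq0; apply/eqP.
exact: mn_central ringR semiR reg2 reg3 m n regm regn regS regG d dD dJ x y.
Qed.
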